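(* Let $A\in\mathbb C^{n\times n}$ and let $\mathcal D$ be an $n\times n$ $(0,* )$ matrix such that $\mathbb C^{n\times n}=T(A)+\mathcal D(\mathbb C)$. Let the matrices $F_{ij}$, the numbers $a,f$, and, for each $E\in\mathbb C^{n\times n}$, the sequences $M_1=E,M_2,M_3,\dots$ and $C_1,C_2,\dots$ be as in the context. Fix $\varepsilon\in\mathbb R$ such that $$0<\varepsilon<\frac{1}{\max\{f(a+1)(f+2),\,3\}}$$ and define the neighborhood $U:=\{E\in\mathbb C^{n\times n}\mid \|E\|<\varepsilon^5\}$ of $0_n$. Then for each matrix $E\in U$, the infinite product $$\mathcal S(E):=(I_n+C_1)(I_n+C_2)(I_n+C_3)\cdots$$ is convergent, $$A+D:=\mathcal S(E)^T(A+E)\,\mathcal S(E)\in A+\mathcal D(\mathbb C),$$ and $$\|\mathcal S(E)-I_n\|<-1+(1+\varepsilon)(1+\varepsilon^3)(1+\varepsilon^5)\cdots,\qquad \|D\|\le\varepsilon^3.$$ The matrix $\mathcal S(E)$ is a function of the entries of $E$; replacing them by unknowns $x_{ij}$, we obtain a matrix $\mathcal S(X)$, $X=[x_{ij}]$, satisfying the following conditions for some neighborhood $V\subset\mathbb C^{n\times n}$ of $0_n$ (one can take $V=U$): (i) the entries of $\mathcal S(X)$ are power series in the variables $x_{ij}$, $i,j=1,\dots,n$; (ii) these series are convergent in $V$ and $\mathcal S(0_n)=I_n$; (iii) $\mathcal S(E)^T(A+E)\mathcal S(E)\in A+\mathcal D(\mathbb C)$ for all $E\in V$.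
   Context: A $(0,* )$ matrix is a matrix whose entries are the symbols $0$ and $*$; $\mathcal I(\mathcal D)$ is the set of positions of stars of $\mathcal D$, $E_{ij}$ are the $n\times n$ matrix units, and $\mathcal D(\mathbb C):=\bigoplus_{(i,j)\in\mathcal I(\mathcal D)}\mathbb C E_{ij}$ is the space of matrices obtained from $\mathcal D$ by replacing its stars by complex numbers. $T(A):=\{C^TA+AC\mid C\in\mathbb C^{n\times n}\}$. For $P=[p_{ij}]\in\mathbb C^{n\times n}$, $\|P\|:=\sqrt{\sum|p_{ij}|^2}$. For every matrix unit $E_{ij}$ fix $F_{ij}\in\mathbb C^{n\times n}$ such that $E_{ij}+F_{ij}^TA+AF_{ij}\in\mathcal D(\mathbb C)$ (it exists since $\mathbb C^{n\times n}=T(A)+\mathcal D(\mathbb C)$), taking $F_{ij}=0_n$ if $E_{ij}\in\mathcal D(\mathbb C)$. Put $a:=\|A\|$ and $f:=\sum_{i,j}\|F_{ij}\|$. For each $n\times n$ matrix $E$, define the sequence $M_1:=E,M_2,M_3,\dots$ inductively: if $M_k=[m_{ij}^{(k)}]$ has been constructed, put $C_k:=\sum_{i,j}m_{ij}^{(k)}F_{ij}$ and define $M_{k+1}$ by $A+M_{k+1}:=(I_n+C_k)^T(A+M_k)(I_n+C_k)$. The infinite product is the limit of the partial products $(I_n+C_1)(I_n+C_2)\cdots(I_n+C_k)$ as $k\to\infty$. *)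

(* Defs.v *)
From HB Require Import structures.
From mathcomp Require Import all_boot all_order all_algebra.
From mathcomp Require Import all_classical all_reals all_analysis.
From mathcomp Require Import complex.
From mathcomp.analysis Require summability.

Set Implicit Arguments.
Unset Strict Implicit.
Unset Printing Implicit Defensive.

Import Order.TTheory GRing.Theory Num.Theory.
Import numFieldNormedType.Exports.

Local Open Scope classical_set_scope.
Local Open Scope ring_scope.
Local Open Scope complex_scope.

(* R[i] does not inherit the topology that the library puts on [K^o] for an
   arbitrary numFieldType K; copying it equips 'M[R[i]]_n with the product
   topology, which is the topology of the Frobenius norm [fnorm] below. *)
#[export, non_forgetful_inheritance]
HB.instance Definition _ (R : rcfType) := PseudoPointedMetric.copy R[i] R[i]^o.
#[export, non_forgetful_inheritance]
HB.instance Definition _ (R : rcfType) := GRing.ComAlgebra.copy R[i] R[i]^o.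
#[export, non_forgetful_inheritance]
HB.instance Definition _ (R : rcfType) := Vector.copy R[i] R[i]^o.
#[export, non_forgetful_inheritance]
HB.instance Definition _ (R : rcfType) := NormedModule.copy R[i] R[i]^o.

Section Reduction.
Context {R : realType} {n : nat}.
Local Notation C := R[i].
Local Notation M := 'M[R[i]]_n.

Definition fnorm (P : M) : R :=
  Num.sqrt (\sum_(i < n) \sum_(j < n) Normc.normc (P i j) ^+ 2).

(* A matrix of symbols 0 and * is encoded as a boolean matrix; [true] is a star. *)
Definition star_space (D : 'M[bool]_n) : {vspace M} :=
  (\sum_(i < n) \sum_(j < n | D i j) <[delta_mx i j : M]>)%VS.

Definition tangent (A : M) : set M := [set X^T *m A + A *m X | X in [set: M]].

Definition admissible (A : M) (D : 'M[bool]_n) (F : 'I_n -> 'I_n -> M) : Prop :=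
  forall i j : 'I_n,
    delta_mx i j + (F i j)^T *m A + A *m F i j \in star_space D /\
    ((delta_mx i j : M) \in star_space D -> F i j = 0).

Definition fsum (F : 'I_n -> 'I_n -> M) : R :=
  \sum_(i < n) \sum_(j < n) fnorm (F i j).

Definition Ccorr (F : 'I_n -> 'I_n -> M) (P : M) : M :=
  \sum_(i < n) \sum_(j < n) P i j *: F i j.

(* Indices start at 0: [Mseq A F E k] is M_(k+1) and [Cseq A F E k] is C_(k+1). *)
Fixpoint Mseq (A : M) (F : 'I_n -> 'I_n -> M) (E : M) (k : nat) : M :=
  if k is k'.+1 then
    let P := Mseq A F E k' in
    (1%:M + Ccorr F P)^T *m (A + P) *m (1%:M + Ccorr F P) - A
  else E.

Definition Cseq (A : M) (F : 'I_n -> 'I_n -> M) (E : M) (k : nat) : M :=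
  Ccorr F (Mseq A F E k).

Definition partial_prod (A : M) (F : 'I_n -> 'I_n -> M) (E : M) (k : nat) : M :=
  \big[mulmx/1%:M]_(i < k) (1%:M + Cseq A F E i).

(* Meaningful only when the partial products converge. *)
Definition Sprod (A : M) (F : 'I_n -> 'I_n -> M) (E : M) : M :=
  lim (partial_prod A F E @ \oo).

(* Multi-indices are matrices of exponents. *)
Definition monomial (E : M) (al : 'M[nat]_n) : C :=
  \prod_(i < n) \prod_(j < n) E i j ^+ al i j.

(* Convergence of a multiple series is convergence of the net of its finite
   partial sums (unconditional, equivalently absolute, convergence). *)
Definition power_series_on (V : set M) (g : M -> C) : Prop :=
  exists c : 'M[nat]_n -> C, forall E : M, V E ->
    summability.partial_sum (fun al => c al * monomial E al)
      @ summability.totally --> g E.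

Definition analytic_reduction
    (A : M) (D : 'M[bool]_n) (S : M -> M) (V : set M) : Prop :=
  [/\ nbhs (0 : M) V,
      forall i j : 'I_n, power_series_on V (fun X => S X i j),
      S 0 = 1%:M &
      forall E : M, V E -> (S E)^T *m (A + E) *m S E - A \in star_space D].

End Reduction.

(* Main.v *)
Require Import Defs.
From HB Require Import structures.
From mathcomp Require Import all_boot all_order all_algebra.
From mathcomp Require Import all_classical all_reals all_analysis.
From mathcomp Require Import complex.
From mathcomp Require Import finmap ring lra.

Set Implicit Arguments.
Unset Strict Implicit.
Unset Printing Implicit Defensive.

Import Order.TTheory GRing.Theory Num.Theory.
Import numFieldNormedType.Exports.

Local Open Scope classical_set_scope.
Local Open Scope ring_scope.
Local Open Scope complex_scope.

(** Congruence by I + C_k replaces M_k by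
      (M_k + C_k^T A + A C_k) + Q_k,
      Q_k = C_k^T M_k + M_k C_k + C_k^T (A + M_k) C_k.
    The bracket is sum m_ij (E_ij + F_ij^T A + A F_ij), which lies in D(C), so
    the entries of M_(k+1) outside the stars are those of Q_k.  Moreover F_ij
    vanishes at the stars, so C_k depends only on the off-star part W_k of M_k
    and is bounded by f times its norm.  Hence Q_k is small compared with W_k,
    and the iteration converges geometrically.  Counting from k = 0, the bounds
    (rates [off_rate], [size_rate], [prod_rate]) are
      |W_k| <= eps^(2k+5),  |M_k| <= eps^3 (1 - eps^(2k)/2),
      |P_k - I| <= (eps/2) (1 - eps^(2k)),
    where P_k is the product of the first k factors.  In the limit the off-star
    part of S^T (A + E) S - A vanishes, its norm is at most eps^3, and
    |S - I| <= eps/2, while the first factor 1 + eps alone shows that the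
    infinite product is at least 1 + eps.

    Analyticity comes from the same estimates, through majorants instead of
    Cauchy's formula.  A polynomial is kept as an unreduced list of monomials,
    and its majorant at E is the sum of the absolute values of these monomials.
    [majorized V X b] says that a matrix X of polynomials has such lists, whose
    majorants form at every E in V a matrix of Frobenius norm at most b.  This
    bound obeys the laws of a submultiplicative norm, since the Frobenius norm
    of a matrix depends only on the absolute values of its entries.  Running the
    estimates for [majorized] ([majorized_Mseq], [majorized_partial_prod]) gives
    at once the numerical bounds on U and the absolute convergence on U of the
    double series obtained by expanding the products P_k into monomials.
    Collecting equal monomials in that double series ([power_series_limit])
    gives the power series of the entries of S.

    The cancellation in the bracket above would be lost on majorants; this is
    why W_k gets its own expansion, obtained from Q_k, beside that of M_k. *)

(** * Euclidean and Frobenius norms *)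

Section EuclideanNorm.
Context {R : realType} {I : finType}.
Implicit Types a b : I -> R.

(** Lagrange's identity: the double sum of the squares of the 2 x 2 minors
    a_i b_j - a_j b_i is twice the difference of the two sides. *)
Lemma cauchy_schwarz_sum a b :
  (\sum_i a i * b i) ^+ 2 <= (\sum_i a i ^+ 2) * (\sum_i b i ^+ 2).
Proof.
have : 0 <= \sum_i \sum_j (a i * b j - a j * b i) ^+ 2.
  by apply: sumr_ge0 => i _; apply: sumr_ge0 => j _; exact: sqr_ge0.
have -> : \sum_i \sum_j (a i * b j - a j * b i) ^+ 2 =
    ((\sum_i a i ^+ 2) * (\sum_i b i ^+ 2) - (\sum_i a i * b i) ^+ 2) *+ 2.
  have sqE i j : (a i * b j - a j * b i) ^+ 2 =
      a i ^+ 2 * b j ^+ 2 + b i ^+ 2 * a j ^+ 2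
       - (a i * b i) * (a j * b j) *+ 2 by ring.
  under eq_bigr => i _ do under eq_bigr => j _ do rewrite sqE.
  under eq_bigr => i _ do
    rewrite sumrB big_split /= -!mulr_sumr sumrMnl -mulr_sumr.
  rewrite sumrB big_split /= sumrMnl -!mulr_suml.
  by rewrite [X in _ + X - _]mulrC expr2 mulrnBl mulr2n.
by rewrite pmulrn_lge0 // subr_ge0.
Qed.

Lemma minkowski_sum a b :
  Num.sqrt (\sum_i (a i + b i) ^+ 2) <=
  Num.sqrt (\sum_i a i ^+ 2) + Num.sqrt (\sum_i b i ^+ 2).
Proof.
have sq_ge0 c : 0 <= \sum_i c i ^+ 2 :> R.
  by apply: sumr_ge0 => i _; exact: sqr_ge0.
rewrite -[leRHS]ger0_norm ?addr_ge0 ?sqrtr_ge0 // -sqrtr_sqr.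
rewrite ler_sqrt ?sqr_ge0 // sqrrD !sqr_sqrtr //.
under eq_bigr do rewrite sqrrD.
rewrite !big_split /= lerD2r lerD2l -mulr2n lerMn2r /= -sqrtrM //.
apply: le_trans (ler_norm _) _.
by rewrite -sqrtr_sqr ler_sqrt ?mulr_ge0 // cauchy_schwarz_sum.
Qed.

End EuclideanNorm.

Section Frobenius.
Context {R : realType} {n : nat}.
Implicit Types G H : 'M[R]_n.

Definition frob G : R := Num.sqrt (\sum_i \sum_j G i j ^+ 2).

Lemma frobE G : frob G = Num.sqrt (\sum_(p : 'I_n * 'I_n) G p.1 p.2 ^+ 2).
Proof. by rewrite /frob pair_bigA. Qed.

Lemma sum_sqr_ge0 G : 0 <= \sum_i \sum_j G i j ^+ 2.
Proof. by do 2![apply: sumr_ge0 => ? _]; exact: sqr_ge0. Qed.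

Lemma frob_ge0 G : 0 <= frob G.
Proof. exact: sqrtr_ge0. Qed.

Lemma frobD G H : frob (G + H) <= frob G + frob H.
Proof.
rewrite !frobE; under eq_bigr do rewrite mxE.
exact: minkowski_sum.
Qed.

(** Cauchy-Schwarz applied to each entry, a row of G against a column of H. *)
Lemma frobM G H : frob (G *m H) <= frob G * frob H.
Proof.
rewrite /frob -sqrtrM ?sum_sqr_ge0 // ler_sqrt; last first.
  by rewrite mulr_ge0 ?sum_sqr_ge0.
rewrite mulr_suml ler_sum // => i _; rewrite [X in _ * X]exchange_big mulr_sumr.
by apply: ler_sum => j _; rewrite mxE cauchy_schwarz_sum.
Qed.

Lemma frob_tr G : frob G^T = frob G.
Proof.
rewrite /frob exchange_big; congr Num.sqrt.
by apply: eq_bigr => i _; apply: eq_bigr => j _; rewrite mxE.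
Qed.

Lemma frobZ (c : R) G : frob (c *: G) = `|c| * frob G.
Proof.
rewrite /frob -sqrtr_sqr -sqrtrM ?sqr_ge0 // mulr_sumr; congr Num.sqrt.
apply: eq_bigr => i _; rewrite mulr_sumr; apply: eq_bigr => j _.
by rewrite mxE exprMn.
Qed.

Lemma le_frob G H : (forall i j, 0 <= G i j <= H i j) -> frob G <= frob H.
Proof.
move=> GH; rewrite ler_sqrt ?sum_sqr_ge0 //.
apply: ler_sum => i _; apply: ler_sum => j _.
have /andP[G0 GleH] := GH i j.
by rewrite lerXn2r ?nnegrE // (le_trans G0).
Qed.

Lemma entry_le_frob G i j : G i j <= frob G.
Proof.
apply: le_trans (ler_norm _) _; rewrite -sqrtr_sqr ler_sqrt ?sum_sqr_ge0 //.
rewrite (bigD1 i) //= (bigD1 j) //= -addrA lerDl addr_ge0 //.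
  by apply: sumr_ge0 => ? _; exact: sqr_ge0.
by do 2![apply: sumr_ge0 => ? _]; exact: sqr_ge0.
Qed.

Lemma frob_le_sum G : frob G <= \sum_i \sum_j `|G i j|.
Proof.
have S0 : 0 <= \sum_i \sum_j `|G i j| by do 2![apply: sumr_ge0 => ? _].
rewrite -[leRHS]ger0_norm // -sqrtr_sqr ler_sqrt ?sqr_ge0 //.
rewrite expr2 mulr_suml ler_sum // => i _.
rewrite mulr_suml ler_sum // => j _.
rewrite -real_normK ?num_real // expr2 ler_wpM2l //.
rewrite (bigD1 i) //= (bigD1 j) //= -addrA lerDl addr_ge0 //.
  by apply: sumr_ge0.
by do 2![apply: sumr_ge0 => ? _].
Qed.

End Frobenius.

(** * Convergence of complex sequences *)

Section ComplexModulus.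
Context {R : realType}.
Local Notation N := (@Normc.normc R).
Implicit Types z w : R[i].

Lemma normc_norm z : (N z)%:C = `|z|.
Proof. by []. Qed.

Lemma normc_ge0 z : 0 <= N z.
Proof. by case: z => a b; exact: sqrtr_ge0. Qed.

Lemma normc_gt0 z : z != 0 -> 0 < N z.
Proof. by move=> z0; rewrite -ltcR normc_norm normr_gt0. Qed.

Lemma normcD z w : N (z + w) <= N z + N w.
Proof. exact: le_normcD. Qed.

Lemma normc_opp z : N (- z) = N z.
Proof. exact: normcN. Qed.

Lemma normc_distC z w : N (z - w) = N (w - z).
Proof. by rewrite -normc_opp opprB. Qed.

Lemma normc_sum (I : Type) (r : seq I) (P : pred I) (f : I -> R[i]) :
  N (\sum_(i <- r | P i) f i) <= \sum_(i <- r | P i) N (f i).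
Proof.
elim/big_ind2 : _ => // [|x1 x2 y1 y2 h1 h2]; first by rewrite Normc.normc0.
by apply: le_trans (normcD _ _) _; exact: lerD.
Qed.

Lemma Re_le_normc z : `|complex.Re z| <= N z.
Proof.
case: z => a b /=; rewrite -sqrtr_sqr ler_sqrt ?addr_ge0 ?sqr_ge0 //.
by rewrite lerDl sqr_ge0.
Qed.

Lemma Im_le_normc z : `|complex.Im z| <= N z.
Proof.
case: z => a b /=; rewrite -sqrtr_sqr ler_sqrt ?addr_ge0 ?sqr_ge0 //.
by rewrite lerDr sqr_ge0.
Qed.

Lemma normc_le_ReIm z : N z <= `|complex.Re z| + `|complex.Im z|.
Proof.
case: z => a b /=; rewrite -[leRHS]ger0_norm ?addr_ge0 // -sqrtr_sqr.
rewrite ler_sqrt ?sqr_ge0 // sqrrD !real_normK ?num_real //.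
by rewrite -addrA [X in _ <= _ + X]addrC addrA lerDl mulrn_wge0 ?mulr_ge0.
Qed.

Lemma cvgC_normP (T : Type) (F : set_system T) {FF : Filter F}
    (f : T -> R[i]) (z : R[i]) :
  f @ F --> z <->
  (forall e : R, 0 < e -> \forall t \near F, N (z - f t) <= e).
Proof.
split=> [/cvgrPdist_le fz e e0|fz].
  have : \forall t \near F, `|z - f t| <= e%:C by apply: fz; rewrite ltcR.
  by apply: filterS => t; rewrite -normc_norm lecR.
apply/cvgrPdist_le => e; case: e => e f'.
rewrite ltcE /= => /andP[/eqP-> e0].
by apply: filterS (fz e e0) => t; rewrite -normc_norm -(lecR (N _)).
Qed.

(** The tolerance is real, whereas the norm of a complex number is itself
    complex-valued. *)
Definition cvgc (u : nat -> R[i]) z : Prop :=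
  forall e : R, 0 < e -> \forall k \near \oo, N (z - u k) <= e.

Lemma cvgcP (u : nat -> R[i]) z : u @ \oo --> z <-> cvgc u z.
Proof. exact: cvgC_normP. Qed.

Lemma cvgc_unique (u : nat -> R[i]) z w : cvgc u z -> cvgc u w -> z = w.
Proof.
by move=> /cvgcP uz /cvgcP uw; apply: cvg_unique uz uw; exact: norm_hausdorff.
Qed.

Lemma cvgc_cst z : cvgc (fun=> z) z.
Proof.
by move=> e e0; apply: nearW => k; rewrite subrr Normc.normc0 ltW.
Qed.

Lemma cvgc_add (u v : nat -> R[i]) z w :
  cvgc u z -> cvgc v w -> cvgc (fun k => u k + v k) (z + w).
Proof.
move=> uz vw e e0.
have e20 : 0 < e / 2 by rewrite divr_gt0.
have uze := uz _ e20; have vwe := vw _ e20.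
near=> k; rewrite opprD addrACA (splitr e).
apply: le_trans (normcD _ _) _; apply: lerD; by near: k.
Unshelve. all: by end_near. Qed.

Lemma cvgc_mul (u v : nat -> R[i]) z w :
  cvgc u z -> cvgc v w -> cvgc (fun k => u k * v k) (z * w).
Proof.
move=> uz vw e e0.
have z1 : 0 < N z + 1 by rewrite ltr_wpDl ?normc_ge0.
have w1 : 0 < N w + 1 by rewrite ltr_wpDl ?normc_ge0.
have ez : 0 < e / 2 / (N z + 1) by rewrite !divr_gt0.
have ew : 0 < e / 2 / (N w + 1) by rewrite !divr_gt0.
have uzw := uz _ ew; have vwz := vw _ ez; have vw1 := vw 1 ltr01.
near=> k; have -> : z * w - u k * v k = z * (w - v k) + (z - u k) * v k by ring.
apply: le_trans (normcD _ _) _; rewrite !Normc.normcM (splitr e).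
have hv : N (v k) <= N w + 1.
  rewrite (_ : v k = w - (w - v k)); last by ring.
  apply: le_trans (normcD _ _) _; rewrite normc_opp lerD2l; by near: k.
apply: lerD.
  apply: (@le_trans _ _ ((N z + 1) * (e / 2 / (N z + 1)))).
    apply: ler_pM; rewrite ?normc_ge0 ?lerDl //; by near: k.
  by rewrite mulrC divfK // gt_eqF.
apply: (@le_trans _ _ ((e / 2 / (N w + 1)) * (N w + 1))).
  apply: ler_pM; rewrite ?normc_ge0 //; by near: k.
by rewrite divfK // gt_eqF.
Unshelve. all: by end_near. Qed.

Lemma cvgc_sum (I : Type) (r : seq I) (u : I -> nat -> R[i]) (z : I -> R[i]) :
  (forall i, cvgc (u i) (z i)) ->
  cvgc (fun k => \sum_(i <- r) u i k) (\sum_(i <- r) z i).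
Proof.
move=> uz; elim: r => [|i r IH].
  by under eq_fun do rewrite big_nil; rewrite big_nil; exact: cvgc_cst.
under eq_fun do rewrite big_cons.
by rewrite big_cons; apply: cvgc_add.
Qed.

(** The completeness argument behind every limit below: increments bounded by
    those of a bounded real sequence force convergence.  For a real sequence w
    dominated by v, both w + v and v are nondecreasing and bounded, and w is
    their difference; the real and imaginary parts are treated this way. *)
Lemma dominated_cvgC (u : nat -> R[i]) (v : nat -> R) (B : R) :
  (forall k, N (u k.+1 - u k) <= v k.+1 - v k) -> (forall k, v k <= B) ->
  exists z, cvgc u z.
Proof.
move=> uv vB.
have cvg_part (w : nat -> R) : (forall k, `|w k.+1 - w k| <= v k.+1 - v k) ->
    exists x : R, w @ \oo --> x.
  move=> wv.
  have ndv : nondecreasing_seq v.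
    apply/nondecreasing_seqP => k; rewrite -subr_ge0.
    exact: le_trans (wv k).
  have ndwv : nondecreasing_seq (fun k => w k + v k).
    apply/nondecreasing_seqP => k.
    have := wv k; rewrite ler_norml => /andP[h _]; lra.
  have wle k : w k <= w 0%N - v 0%N + v k.
    elim: k => [|k IH]; first by rewrite subrK.
    have := wv k; rewrite ler_norml => /andP[_ h]; lra.
  have cv : cvgn v.
    by apply: nondecreasing_is_cvgn => //; exists B => _ [k _ <-].
  have cwv : cvgn (fun k => w k + v k).
    apply: nondecreasing_is_cvgn => //; exists (w 0%N - v 0%N + B + B).
    move=> _ [k _ <-]; apply: lerD => //.
    by apply: le_trans (wle k) _; rewrite lerD2l.
  exists (limn (fun k => w k + v k) - limn v).
  have := cvgB cwv cv; rewrite (_ : (fun k => w k + v k) - v = w); first exact.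
  by apply: funext => k; rewrite !fctE addrK.
have [x ux] : exists x : R, (fun k => complex.Re (u k)) @ \oo --> x.
  apply: cvg_part => k; apply: le_trans (uv k).
  have -> : complex.Re (u k.+1) - complex.Re (u k) = complex.Re (u k.+1 - u k).
    by case: (u k.+1) (u k) => [? ?] [? ?].
  exact: Re_le_normc.
have [y uy] : exists y : R, (fun k => complex.Im (u k)) @ \oo --> y.
  apply: cvg_part => k; apply: le_trans (uv k).
  have -> : complex.Im (u k.+1) - complex.Im (u k) = complex.Im (u k.+1 - u k).
    by case: (u k.+1) (u k) => [? ?] [? ?].
  exact: Im_le_normc.
exists (x +i* y) => e e0.
have e20 : 0 < e / 2 by rewrite divr_gt0.
move/cvgrPdist_le : ux => /(_ _ e20) ux.
move/cvgrPdist_le : uy => /(_ _ e20) uy.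
near=> k; apply: le_trans (normc_le_ReIm _) _.
rewrite [leRHS](splitr e); apply: lerD.
  rewrite (_ : complex.Re _ = x - complex.Re (u k)); first by near: k.
  by case: (u k).
rewrite (_ : complex.Im _ = y - complex.Im (u k)); first by near: k.
by case: (u k).
Unshelve. all: by end_near. Qed.

End ComplexModulus.

(** * Term lists and the power series of a dominated limit *)

Section TermLists.
Context {R : realType} {n : nat}.
Local Notation C := R[i].
Local Notation M := 'M[R[i]]_n.
Local Notation N := (@Normc.normc R).
Implicit Types (E : M) (al be : 'M[nat]_n).

(** A polynomial in the entries of E written as a list of monomials.  Equal
    monomials are not collected, so that no cancellation happens and majorants
    add and multiply exactly. *)
Definition termlist := seq (C * 'M[nat]_n).
Implicit Types s t : termlist.

Definition ev E t : C := \sum_(x <- t) x.1 * monomial E x.2.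
(** The majorant of the polynomial: the polynomial with coefficients of absolute
    value |c|, evaluated at the absolute values of the entries of E. *)
Definition mev E t : R := \sum_(x <- t) N (x.1 * monomial E x.2).

Definition tmul s t : termlist :=
  [seq (x.1 * y.1, (x.2 + y.2)%R) | x <- s, y <- t].

Lemma monomialD E al be : monomial E (al + be) = monomial E al * monomial E be.
Proof.
rewrite /monomial -big_split; apply: eq_bigr => i _.
by rewrite -big_split; apply: eq_bigr => j _; rewrite mxE exprD.
Qed.

Lemma monomial0 E : monomial E 0 = 1.
Proof. by rewrite /monomial big1 // => i _; rewrite big1 // => j _; rewrite mxE. Qed.

Lemma monomial_delta E i j : monomial E (delta_mx i j) = E i j.
Proof.
rewrite /monomial (bigD1 i) //= [X in _ * X]big1 ?mulr1; last first.
  move=> k ki; rewrite big1 // => l _; rewrite mxE (negbTE ki) //.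
rewrite (bigD1 j) //= [X in _ * X]big1 ?mulr1 ?mxE ?eqxx //.
by move=> l lj; rewrite mxE (negbTE lj) andbF.
Qed.

Lemma monomial_neq0 E al : (forall i j, E i j != 0) -> monomial E al != 0.
Proof.
by move=> E0; apply/prodf_neq0 => i _; apply/prodf_neq0 => j _; rewrite expf_neq0.
Qed.

Lemma mev_ge0 E t : 0 <= mev E t.
Proof. by apply: sumr_ge0 => x _; exact: normc_ge0. Qed.

Lemma normc_ev_le E t : N (ev E t) <= mev E t.
Proof. exact: normc_sum. Qed.

Lemma ev_nil E : ev E [::] = 0. Proof. exact: big_nil. Qed.

Lemma mev_nil E : mev E [::] = 0. Proof. exact: big_nil. Qed.

Lemma ev_cat E s t : ev E (s ++ t) = ev E s + ev E t.
Proof. exact: big_cat. Qed.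

Lemma mev_cat E s t : mev E (s ++ t) = mev E s + mev E t.
Proof. exact: big_cat. Qed.

Lemma ev_mul E s t : ev E (tmul s t) = ev E s * ev E t.
Proof.
rewrite /ev /tmul big_allpairs_dep mulr_suml; apply: eq_bigr => x _.
rewrite mulr_sumr; apply: eq_bigr => y _ /=.
by rewrite monomialD mulrACA.
Qed.

Lemma mev_mul E s t : mev E (tmul s t) = mev E s * mev E t.
Proof.
rewrite /mev /tmul big_allpairs_dep mulr_suml; apply: eq_bigr => x _.
rewrite mulr_sumr; apply: eq_bigr => y _ /=.
by rewrite monomialD mulrACA Normc.normcM.
Qed.

Lemma ev_flatten E (I : Type) (r : seq I) (f : I -> termlist) :
  ev E (flatten [seq f i | i <- r]) = \sum_(i <- r) ev E (f i).
Proof.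
elim: r => [|i r IH] /=; first by rewrite ev_nil big_nil.
by rewrite ev_cat big_cons IH.
Qed.

Lemma mev_flatten E (I : Type) (r : seq I) (f : I -> termlist) :
  mev E (flatten [seq f i | i <- r]) = \sum_(i <- r) mev E (f i).
Proof.
elim: r => [|i r IH] /=; first by rewrite mev_nil big_nil.
by rewrite mev_cat big_cons IH.
Qed.

Definition coef t al : C := \sum_(x <- t | x.2 == al) x.1.

Lemma coef_cat s t al : coef (s ++ t) al = coef s al + coef t al.
Proof. exact: big_cat. Qed.

Lemma sum_coef E t (J : {fset 'M[nat]_n}) :
  \sum_(al <- J) coef t al * monomial E al =
  \sum_(x <- t | x.2 \in J) x.1 * monomial E x.2.
Proof.
under eq_bigr do rewrite mulr_suml big_mkcond.
rewrite exchange_big /= [RHS]big_mkcond; apply: eq_bigr => x _.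
case: ifPn => xJ; last first.
  rewrite big1_seq // => al /andP[_ alJ].
  by case: eqP => // xal; rewrite xal alJ in xJ.
rewrite (bigD1_seq x.2) ?fset_uniq //= eqxx big1 ?addr0 // => al.
by rewrite eq_sym => /negbTE ->.
Qed.

Lemma sum_coef_all E t (J : {fset 'M[nat]_n}) :
  {subset [seq x.2 | x <- t] <= J} ->
  \sum_(al <- J) coef t al * monomial E al = ev E t.
Proof.
move=> tJ; rewrite sum_coef big_mkcond; apply: eq_big_seq => x xt.
by rewrite tJ // map_f.
Qed.

(** Collecting equal monomials, then truncating to any finite set of exponents,
    can only lower the sum of absolute values. *)
Lemma sum_coef_le E t (J : {fset 'M[nat]_n}) :
  N (\sum_(al <- J) coef t al * monomial E al) <= mev E t.
Proof.
rewrite sum_coef; apply: le_trans (normc_sum _ _ _) _.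
rewrite big_mkcond; apply: ler_sum => x _.
by case: ifP => // _; exact: normc_ge0.
Qed.

Lemma coef_le E t al : N (coef t al) * N (monomial E al) <= mev E t.
Proof.
by have := sum_coef_le E t [fset al]%fset; rewrite big_seq_fset1 Normc.normcM.
Qed.

(** The coefficient of each monomial converges, because at the point E0, where
    no monomial vanishes, its increments are dominated by those of v.  Once a
    finite set J contains all exponents of the first k lists, the partial sum
    over J of the limit series differs from the k-th partial sum by at most
    lim v - v k, uniformly in J. *)
Lemma power_series_limit (V : set M) (E0 : M) (r : nat -> termlist)
    (v : nat -> R) (B : R) (g : M -> C) :
  V E0 -> (forall i j, E0 i j != 0) ->
  (forall E k, V E -> mev E (r k) <= v k.+1 - v k) ->
  (forall k, v k <= B) ->
  (forall E, V E -> cvgc (fun k => \sum_(i < k) ev E (r i)) (g E)) ->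
  power_series_on V g.
Proof.
move=> VE0 E0n0 rv vB rg.
pose s k := flatten [seq r i | i <- iota 0 k].
have sS k : s k.+1 = s k ++ r k.
  by rewrite /s -addn1 iotaD map_cat flatten_cat /= add0n cats0.
have evs E k : ev E (s k) = \sum_(i < k) ev E (r i).
  rewrite ev_flatten -[RHS](big_mkord xpredT (fun i => ev E (r i))).
  by rewrite /index_iota subn0.
have ndv : nondecreasing_seq v.
  apply/nondecreasing_seqP => k; rewrite -subr_ge0.
  exact: le_trans (mev_ge0 _ _) (rv _ _ VE0).
have cvgv : cvgn v.
  by apply: nondecreasing_is_cvgn => //; exists B => _ [k _ <-].
have coef_cvg al : exists c : C, cvgc (fun k => coef (s k) al) c.
  have m0 : 0 < N (monomial E0 al).
    by rewrite normc_gt0 // monomial_neq0.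
  apply: (@dominated_cvgC _ _ (fun k => v k / N (monomial E0 al))
    (B / N (monomial E0 al))) => k; last first.
    by rewrite ler_pM2r ?invr_gt0.
  rewrite sS coef_cat addrC addKr -mulrBl ler_pdivlMr //.
  by apply: le_trans (coef_le _ _ _) _; exact: rv.
have [c cP] := choice coef_cvg.
exists c => E VE.
have tail_le k l (J : {fset 'M[nat]_n}) : (k <= l)%N ->
    {subset [seq x.2 | x <- s k] <= J} ->
    N (\sum_(al <- J) coef (s l) al * monomial E al - ev E (s k)) <= v l - v k.
  move=> kl sJ; rewrite -(subnKC kl); elim: (l - k)%N => [|m IH].
    by rewrite addn0 sum_coef_all // !subrr Normc.normc0.
  rewrite addnS sS; under eq_bigr do rewrite coef_cat mulrDl.
  rewrite big_split /= addrAC; apply: le_trans (normcD _ _) _.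
  apply: le_trans (lerD IH (sum_coef_le _ _ _)) _.
  apply: le_trans (lerD (lexx _) (rv _ _ VE)) _; lra.
have lim_tail k (J : {fset 'M[nat]_n}) :
    {subset [seq x.2 | x <- s k] <= J} ->
    N (\sum_(al <- J) c al * monomial E al - ev E (s k)) <= limn v - v k.
  move=> sJ.
  have cJ : cvgc (fun l => \sum_(al <- J) coef (s l) al * monomial E al)
      (\sum_(al <- J) c al * monomial E al).
    by apply: cvgc_sum => al; apply: cvgc_mul => //; exact: cvgc_cst.
  apply/ler_addgt0Pr => e e0.
  have [l0 _ l0P] := cJ e e0.
  pose l := maxn k l0.
  have h1 := l0P l (leq_maxr _ _).
  have h2 := tail_le k l J (leq_maxl _ _) sJ.
  have h3 := nondecreasing_cvgn_le ndv cvgv l.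
  rewrite /= in h1.
  apply: (@le_trans _ _ (e + (v l - v k))); last lra.
  apply: le_trans (lerD h1 h2); apply: le_trans (normcD _ _).
  by rewrite addrA subrK.
have totally_filter := @summability.totally_filter 'M[nat]_n.
apply/cvgC_normP => e e0.
have e20 : 0 < e / 2 by rewrite divr_gt0.
move/cvgrPdist_le : (cvgv) => /(_ _ e20) [k1 _ k1P].
have [k2 _ k2P] := rg E VE _ e20.
pose k := maxn k1 k2.
have h1 := k1P k (leq_maxl _ _).
have h2 := k2P k (leq_maxr _ _).
rewrite /= -evs in h2; rewrite /= in h1.
exists [fset al in [seq x.2 | x <- s k]]%fset => // J /= JP.
have sJ : {subset [seq x.2 | x <- s k] <= J}.
  by move=> al alk; apply: (fsubsetP JP); rewrite inE.
have h3 := lim_tail k J sJ.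
rewrite /summability.partial_sum.
rewrite -(@big_seq_fsetE _ _ _ _ J xpredT (fun al => c al * monomial E al)) /=.
rewrite (splitr e).
apply: (@le_trans _ _ (N (g E - ev E (s k)) +
   N (\sum_(al <- J) c al * monomial E al - ev E (s k)))); last first.
  apply: lerD => //; apply: le_trans h3 _; exact: le_trans (ler_norm _) h1.
rewrite [X in _ <= _ + X]normc_distC; apply: le_trans (normcD _ _).
by rewrite addrA subrK.
Qed.

End TermLists.

(** * Matrices of polynomials with bounded majorants *)

Section Majorized.
Context {R : realType} {n : nat}.
Local Notation C := R[i].
Local Notation M := 'M[R[i]]_n.
Local Notation N := (@Normc.normc R).
Implicit Types (E A : M) (X Y : M -> M) (V : set M) (b c : R).

Lemma fnormE A : fnorm A = frob (map_mx N A).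
Proof.
rewrite /fnorm /frob; congr Num.sqrt; apply: eq_bigr => i _.
by apply: eq_bigr => j _; rewrite mxE.
Qed.

Lemma fnorm0 : fnorm (0 : M) = 0.
Proof.
rewrite /fnorm big1 ?sqrtr0 // => i _; rewrite big1 // => j _.
by rewrite mxE Normc.normc0 expr0n.
Qed.

Lemma fnorm_ge0 A : 0 <= fnorm A.
Proof. exact: sqrtr_ge0. Qed.

Lemma entry_le_fnorm A i j : N (A i j) <= fnorm A.
Proof. by rewrite fnormE; have := entry_le_frob (map_mx N A) i j; rewrite mxE. Qed.

Definition majorant (T : 'I_n -> 'I_n -> termlist) E : 'M[R]_n :=
  \matrix_(i, j) mev E (T i j).

(** The bound b plays the role of a norm of X on V, finer than the supremum of
    the Frobenius norms of its values: it also controls every rearrangement of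
    the expansion of X into monomials. *)
Definition majorized V X b : Prop :=
  exists2 T : 'I_n -> 'I_n -> termlist,
    forall E i j, ev E (T i j) = X E i j &
    forall E, V E -> frob (majorant T E) <= b.

Lemma majorized_fnorm V X b : majorized V X b ->
  forall E, V E -> fnorm (X E) <= b.
Proof.
move=> [T TX Tb] E VE; apply: le_trans (Tb E VE); rewrite fnormE le_frob // => i j.
by rewrite !mxE -TX normc_ge0 normc_ev_le.
Qed.

Lemma majorized_le V X b c : b <= c -> majorized V X b -> majorized V X c.
Proof.
by move=> bc [T TX Tb]; exists T => // E /Tb Eb; exact: le_trans bc.
Qed.

Lemma majorized_ext V X Y b : X =1 Y -> majorized V X b -> majorized V Y b.
Proof. by move=> /funext ->. Qed.

Lemma majorized_cst V A : majorized V (fun=> A) (fnorm A).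
Proof.
exists (fun i j => [:: (A i j, 0)]) => [E i j|E VE].
  by rewrite /ev big_seq1 /= monomial0 mulr1.
rewrite fnormE le_frob // => i j.
by rewrite !mxE mev_ge0 /mev big_seq1 /= monomial0 mulr1 lexx.
Qed.

Lemma majorized_id V b : (forall E, V E -> fnorm E <= b) -> majorized V id b.
Proof.
move=> Vb; exists (fun i j => [:: (1, delta_mx i j)]) => [E i j|E VE].
  by rewrite /ev big_seq1 /= monomial_delta mul1r.
apply: le_trans (Vb E VE); rewrite fnormE le_frob // => i j.
by rewrite !mxE mev_ge0 /mev big_seq1 /= monomial_delta mul1r lexx.
Qed.

Lemma majorizedD V X Y b c : majorized V X b -> majorized V Y c ->
  majorized V (fun E => X E + Y E) (b + c).
Proof.
move=> [T TX Tb] [T' TY Tc].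
exists (fun i j => T i j ++ T' i j) => [E i j|E VE].
  by rewrite ev_cat TX TY mxE.
apply: le_trans (lerD (Tb E VE) (Tc E VE)); apply: le_trans (frobD _ _).
by apply: le_frob => i j; rewrite !mxE mev_cat addr_ge0 ?mev_ge0 /=.
Qed.

Lemma majorizedM V X Y b c : majorized V X b -> majorized V Y c ->
  majorized V (fun E => X E *m Y E) (b * c).
Proof.
move=> [T TX Tb] [T' TY Tc].
exists (fun i j => flatten [seq tmul (T i k) (T' k j) | k <- index_enum 'I_n]).
  move=> E i j; rewrite ev_flatten mxE; apply: eq_bigr => k _.
  by rewrite ev_mul TX TY.
move=> E VE.
apply: le_trans (ler_pM (frob_ge0 _) (frob_ge0 _) (Tb E VE) (Tc E VE)).
apply: le_trans (frobM _ _); apply: le_frob => i j.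
rewrite !mxE mev_ge0 mev_flatten /= le_eqVlt; apply/orP; left; apply/eqP.
by apply: eq_bigr => k _; rewrite mev_mul !mxE.
Qed.

Lemma majorized_tr V X b :
  majorized V X b -> majorized V (fun E => (X E)^T) b.
Proof.
move=> [T TX Tb]; exists (fun i j => T j i) => [E i j|E VE].
  by rewrite TX mxE.
apply: le_trans (Tb E VE); rewrite -frob_tr; apply: le_frob => i j.
by rewrite !mxE mev_ge0 lexx.
Qed.

Lemma majorized_mask V X b (P : 'I_n -> 'I_n -> bool) : majorized V X b ->
  majorized V (fun E => \matrix_(i, j) (if P i j then X E i j else 0)) b.
Proof.
move=> [T TX Tb].
exists (fun i j => if P i j then T i j else [::]) => [E i j|E VE].
  by rewrite mxE; case: ifP; rewrite ?TX ?ev_nil.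
apply: le_trans (Tb E VE); apply: le_frob => i j.
by rewrite !mxE mev_ge0; case: ifP => _; rewrite ?lexx // mev_nil mev_ge0.
Qed.

Lemma majorized_entryZ V X b A i j : majorized V X b ->
  majorized V (fun E => X E i j *: A) (b * fnorm A).
Proof.
move=> [T TX Tb].
exists (fun k l => tmul (T i j) [:: (A k l, 0)]) => [E k l|E VE].
  by rewrite ev_mul TX mxE /ev big_seq1 /= monomial0 mulr1.
have Tij : mev E (T i j) <= b.
  apply: le_trans (Tb E VE).
  by have := entry_le_frob (majorant T E) i j; rewrite mxE.
apply: le_trans (ler_wpM2r (fnorm_ge0 A) Tij).
rewrite fnormE -[mev _ _]ger0_norm ?mev_ge0 // -frobZ; apply: le_frob => k l.
by rewrite !mxE mev_ge0 mev_mul /mev big_seq1 /= monomial0 mulr1 lexx.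
Qed.

Lemma majorized_sum V (I : Type) (r : seq I) (X : I -> M -> M) (b : I -> R) :
  (forall i, majorized V (X i) (b i)) ->
  majorized V (fun E => \sum_(i <- r) X i E) (\sum_(i <- r) b i).
Proof.
move=> Xb; elim: r => [|i r IH].
  rewrite big_nil (_ : (fun _ => _) = fun=> 0).
    have := majorized_cst V 0; apply: majorized_le.
    by rewrite fnorm0.
  by apply/funext => E; rewrite big_nil.
rewrite big_cons (_ : (fun _ => _) = fun E => X i E + \sum_(k <- r) X k E).
  exact: majorizedD.
by apply/funext => E; rewrite big_cons.
Qed.

Lemma majorized_Ccorr V X b F : majorized V X b ->
  majorized V (fun E => Ccorr F (X E)) (b * fsum F).
Proof.
move=> Xb; rewrite mulr_sumr; apply: majorized_sum => i.
rewrite mulr_sumr; apply: majorized_sum => j; exact: majorized_entryZ.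
Qed.

(** A telescoping series whose terms have summable majorant bounds converges
    on V, entry by entry, to a power series. *)
Lemma majorized_series V (X : nat -> M -> M) (v : nat -> R) (B : R) (E0 : M) :
  V E0 -> (forall i j, E0 i j != 0) ->
  majorized V (X 0) (v 0%N) ->
  (forall k, majorized V (fun E => X k.+1 E - X k E) (v k.+1 - v k)) ->
  (forall k, v k <= B) ->
  exists S : M -> M,
    (forall E, V E -> forall i j, cvgc (fun k => X k E i j) (S E i j)) /\
    (forall i j, power_series_on V (fun E => S E i j)).
Proof.
move=> VE0 E0n0 [T0 T0X T0b] dX vB.
have [T TX Tb] : exists2 T : nat -> 'I_n -> 'I_n -> termlist,
    (forall k E i j, ev E (T k i j) = (X k.+1 E - X k E) i j) &
    (forall k E, V E -> frob (majorant (T k) E) <= v k.+1 - v k).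
  have [T HT] := choice (fun k => let: ex_intro2 T a b := dX k in
    ex_intro (fun T : 'I_n -> 'I_n -> termlist => _ /\ _) T (conj a b)).
  by exists T => k; have [] := HT k.
pose r i j k := if k is k'.+1 then T k' i j else T0 i j.
pose w k := if k is k'.+1 then v k' else 0.
have rsum i j k E : \sum_(l < k.+1) ev E (r i j l) = X k E i j.
  elim: k => [|k IH]; first by rewrite big_ord1 /= T0X.
  by rewrite big_ord_recr /= IH TX !mxE addrC subrK.
have rw i j E k : V E -> mev E (r i j k) <= w k.+1 - w k.
  move=> VE; case: k => [|k] /=.
    rewrite subr0; apply: le_trans (T0b E VE).
    by have := entry_le_frob (majorant T0 E) i j; rewrite mxE.
  apply: le_trans (Tb k E VE).
  by have := entry_le_frob (majorant (T k) E) i j; rewrite mxE.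
have wB k : w k <= Num.max 0 B.
  by case: k => [|k] /=; rewrite le_max ?lexx // vB orbT.
have cvgX E i j : exists z : C, V E -> cvgc (fun k => X k E i j) z.
  have [VE|nVE] := pselect (V E); last by exists 0.
  have [|z z_lim] := @dominated_cvgC _ (fun k => X k E i j) v B _ vB.
    move=> k; apply: le_trans (Tb k E VE).
    have := entry_le_frob (majorant (T k) E) i j; apply: le_trans.
    rewrite mxE; apply: le_trans (normc_ev_le _ _).
    by rewrite TX !mxE.
  by exists z.
have [S SP] : exists S : M -> M, forall E, V E ->
    forall i j, cvgc (fun k => X k E i j) (S E i j).
  have [s sP] := choice (fun p : M * 'I_n * 'I_n => cvgX p.1.1 p.1.2 p.2).
  exists (fun E => \matrix_(i, j) s (E, i, j)) => E VE i j.
  by rewrite mxE; exact: (sP (E, i, j)).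
exists S; split => // i j.
apply: (@power_series_limit _ _ V E0 (r i j) w (Num.max 0 B)) => // [E k|E VE].
  exact: rw.
apply/cvgcP; rewrite -(cvg_shiftS (fun k => \sum_(l < k) ev E (r i j l))) /=.
under eq_fun do rewrite rsum.
by apply/cvgcP; exact: SP.
Qed.

End Majorized.

(** * Limits of matrices *)

Section MatrixLimits.
Context {R : realType} {n : nat}.
Local Notation M := 'M[R[i]]_n.
Local Notation N := (@Normc.normc R).
Implicit Types (X Y : nat -> M) (K L : M).

Definition mxcvgc X L : Prop := forall i j, cvgc (fun k => X k i j) (L i j).

Lemma mxcvgcP X L : mxcvgc X L <-> X @ \oo --> L.
Proof.
split=> [XL P [Q LQ QP]|XL i j].
  suff : \forall k \near \oo, forall i j, Q i j (X k i j).
    by apply: filterS => k Qk; exact: QP.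
  apply: filter_forall => i; apply: filter_forall => j.
  by have /cvgcP := XL i j; apply; exact: LQ.
apply/cvgcP => Q LQ.
suff nbL : nbhs L [set K : M | Q (K i j)] by exact: XL nbL.
exists (fun i' j' => [set z | (i' == i) && (j' == j) -> Q z]) => [i' j'|K /(_ i j)].
  have [/andP[/eqP-> /eqP->]|ij] := boolP ((i' == i) && (j' == j)).
    by apply: filterS LQ => z Qz _.
  by apply: filterE.
by rewrite /= !eqxx; apply.
Qed.

Lemma mxcvgc_cst L : mxcvgc (fun=> L) L.
Proof. by move=> i j; exact: cvgc_cst. Qed.

Lemma mxcvgcD X Y K L : mxcvgc X K -> mxcvgc Y L ->
  mxcvgc (fun k => X k + Y k) (K + L).
Proof.
move=> XK YL i j; rewrite mxE; under eq_fun do rewrite mxE.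
exact: cvgc_add.
Qed.

Lemma mxcvgcM X Y K L : mxcvgc X K -> mxcvgc Y L ->
  mxcvgc (fun k => X k *m Y k) (K *m L).
Proof.
move=> XK YL i j; rewrite mxE; under eq_fun do rewrite mxE.
by apply: cvgc_sum => l; exact: cvgc_mul.
Qed.

Lemma mxcvgc_tr X L : mxcvgc X L -> mxcvgc (fun k => (X k)^T) L^T.
Proof.
by move=> XL i j; rewrite mxE; under eq_fun do rewrite mxE; exact: XL.
Qed.

Lemma fnormD K L : fnorm (K + L) <= fnorm K + fnorm L.
Proof.
rewrite !fnormE; apply: le_trans (frobD _ _); apply: le_frob => i j.
by rewrite !mxE normc_ge0 normcD.
Qed.

(** The denominator (n * n).+1 makes the bound strict and covers n = 0. *)
Lemma fnorm_lt (e : R) L : 0 < e ->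
  (forall i j, N (L i j) <= e / (n * n).+1%:R) -> fnorm L < e.
Proof.
move=> e0 Le; rewrite fnormE; apply: le_lt_trans (frob_le_sum _) _.
apply: (@le_lt_trans _ _ (\sum_(i < n) \sum_(j < n) e / (n * n).+1%:R)).
  apply: ler_sum => i _; apply: ler_sum => j _.
  by rewrite mxE ger0_norm ?normc_ge0.
rewrite !sumr_const !card_ord -mulrnA -[_ *+ (n * n)]mulr_natr mulrAC ltr_pdivrMr //.
by rewrite ltr_pM2l // ltr_nat.
Qed.

Lemma fnorm_lim_le X L b : mxcvgc X L -> (forall k, fnorm (X k) <= b) ->
  fnorm L <= b.
Proof.
move=> XL Xb; apply/ler_addgt0Pr => e e0.
have near_small : \forall k \near \oo,
    forall i j, N (L i j - X k i j) <= e / (n * n).+1%:R.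
  apply: filter_forall => i; apply: filter_forall => j.
  by apply: XL; rewrite divr_gt0.
have [k _ /(_ k (leqnn k)) Lk] := near_small.
rewrite -(subrK (X k) L) addrC; apply: le_trans (fnormD _ _) _.
apply: lerD => //; apply: ltW; apply: fnorm_lt => // i j.
by rewrite !mxE; exact: Lk.
Qed.

Lemma nbhs_fnorm_ball (r : R) : 0 < r -> nbhs (0 : M) [set E | fnorm E < r].
Proof.
move=> r0; exists (fun _ _ => [set z | N z <= r / (n * n).+1%:R]).
  move=> i j; rewrite mxE.
  have /cvgC_normP idP : id z @[z --> (0 : R[i])] --> (0 : R[i]) by exact: cvg_id.
  have : 0 < r / (n * n).+1%:R by rewrite divr_gt0.
  by move/idP; apply: filterS => z /=; rewrite sub0r normc_opp.
by move=> E /= Er; exact: fnorm_lt.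
Qed.

End MatrixLimits.

(** * Algebra of one reduction step *)

Section Reduction.
Context {R : realType} {n : nat}.
Local Notation M := 'M[R[i]]_n.
Local Notation N := (@Normc.normc R).
Variables (A : M) (D : 'M[bool]_n) (F : 'I_n -> 'I_n -> M).
Implicit Types (P E : M).

Lemma star_spaceP P :
  reflect (forall i j, ~~ D i j -> P i j = 0) (P \in star_space D).
Proof.
apply: (iffP idP) => [|P0].
  move=> /memv_sumP[Ps PsD ->] i j Dij.
  rewrite summxE big1 // => k _.
  have /memv_sumP[Qs QsD ->] := PsD k isT.
  rewrite summxE big1 // => l Dkl.
  have /vlineP[c ->] := QsD l Dkl.
  rewrite !mxE; case: eqP => [ik|]; last by rewrite mulr0.
  case: eqP => [jl|]; last by rewrite mulr0.
  by rewrite ik jl Dkl in Dij.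
rewrite [P]matrix_sum_delta; apply: memv_sumr => i _.
rewrite (bigID (D i)) /= [X in _ + X]big1 ?addr0; last first.
  by move=> j Dij; rewrite P0 // scale0r.
by apply: memv_sumr => j _; rewrite memvZ // memv_line.
Qed.

Definition offstar P : M := \matrix_(i, j) (if ~~ D i j then P i j else 0).

Lemma offstar_star P Q : P \in star_space D -> offstar (P + Q) = offstar Q.
Proof.
move/star_spaceP => P0; apply/matrixP => i j; rewrite !mxE.
by case: ifP => // Dij; rewrite P0 // add0r.
Qed.

Hypothesis hF : admissible A D F.

(** Star entries do not contribute to the correction, as F i j = 0 there. *)
Lemma Ccorr_offstar P : Ccorr F (offstar P) = Ccorr F P.
Proof.
apply: eq_bigr => i _; apply: eq_bigr => j _; rewrite mxE.
case: ifPn => //; rewrite negbK => Dij.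
rewrite (hF i j).2 ?scaler0 //; apply/star_spaceP => k l Dkl; rewrite mxE.
case: eqP => //= ki; case: eqP => //= lj.
by rewrite ki lj Dij in Dkl.
Qed.

(** By linearity in P, this is the defining property of the F i j. *)
Lemma linear_part_star P :
  P + (Ccorr F P)^T *m A + A *m Ccorr F P \in star_space D.
Proof.
rewrite (_ : _ + _ = \sum_i \sum_j
    P i j *: (delta_mx i j + (F i j)^T *m A + A *m F i j)); last first.
  rewrite [X in X + _ + _]matrix_sum_delta /Ccorr.
  rewrite raddf_sum mulmx_suml mulmx_sumr -!big_split; apply: eq_bigr => i _ /=.
  rewrite raddf_sum mulmx_suml mulmx_sumr -!big_split; apply: eq_bigr => j _ /=.
  by rewrite linearZ /= -scalemxAl -scalemxAr !scalerDr.
apply: memv_suml => i _; apply: memv_suml => j _.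
by rewrite memvZ //; exact: (hF i j).1.
Qed.

(** What remains of a step after its part linear in P: every term contains the
    correction together with P or with the correction again. *)
Definition quadratic_part P : M :=
  let C := Ccorr F P in C^T *m P + P *m C + C^T *m (A + P) *m C.

Lemma congruence_step P (C := Ccorr F P) :
  (1%:M + C)^T *m (A + P) *m (1%:M + C) - A =
  (P + C^T *m A + A *m C) + quadratic_part P.
Proof.
rewrite /quadratic_part -/C; move: (C) => B.
rewrite [(_ + _)^T]linearD /= trmx1 [(1%:M + _) *m (A + P)]mulmxDl mul1mx.
rewrite mulmxDr mulmx1 [(A + P + _) *m B]mulmxDl [(A + P) *m B]mulmxDl.
move: (B^T *m (A + P) *m B) => x1; rewrite mulmxDr.
move: (B^T *m A) (B^T *m P) (P *m B) (A *m B) => x2 x3 x4 x5.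
by apply/matrixP => i j; rewrite !mxE; ring.
Qed.

Lemma MseqS E k (P := Mseq A F E k) :
  Mseq A F E k.+1 =
  (P + (Ccorr F P)^T *m A + A *m Ccorr F P) + quadratic_part P.
Proof. exact: congruence_step. Qed.

(** The reason why the iteration contracts: the off-star part of the next matrix
    comes from the quadratic part alone. *)
Lemma offstar_MseqS E k :
  offstar (Mseq A F E k.+1) = offstar (quadratic_part (Mseq A F E k)).
Proof. by rewrite MseqS offstar_star // linear_part_star. Qed.

Lemma partial_prodS E k :
  partial_prod A F E k.+1 = partial_prod A F E k *m (1%:M + Cseq A F E k).
Proof. exact: (@big_ord_recr 'M[R[i]]_n 1 *%R). Qed.

Lemma partial_prod0 E : partial_prod A F E 0 = 1%:M.
Proof. exact: big_ord0. Qed.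

Lemma MseqE E k :
  Mseq A F E k = (partial_prod A F E k)^T *m (A + E) *m partial_prod A F E k - A.
Proof.
elim: k => [|k IH].
  by rewrite partial_prod0 trmx1 mul1mx mulmx1 addrAC subrr add0r.
rewrite partial_prodS trmx_mul /= {2}IH /Cseq.
by rewrite [A + (_ - A)]addrC subrK !mulmxA.
Qed.

Lemma Mseq0 k : Mseq A F 0 k = 0.
Proof.
elim: k => //= k ->; rewrite (_ : Ccorr F 0 = 0); first
  by rewrite addr0 trmx1 mul1mx mulmx1 addr0 subrr.
by rewrite /Ccorr big1 // => i _; rewrite big1 // => j _; rewrite mxE scale0r.
Qed.

Lemma partial_prod_at0 k : partial_prod A F 0 k = 1%:M.
Proof.
elim: k => [|k IH]; first exact: partial_prod0.
rewrite partial_prodS IH /Cseq Mseq0 /Ccorr big1 ?addr0 ?mulmx1 // => i _.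
by rewrite big1 // => j _; rewrite mxE scale0r.
Qed.

End Reduction.

(** * Numerical estimates *)

Section Estimates.
Context {R : realType}.
Variables (a f e : R).
Hypotheses (a0 : 0 <= a) (f0 : 0 <= f) (e0 : 0 < e) (e3 : e * 3 < 1)
  (ef : e * (f * (a + 1) * (f + 2)) < 1).

Let e1 : e <= 1. Proof. by move: e0 e3; lra. Qed.

Lemma exp_even_bounds k : 0 < e ^+ (2 * k) <= 1.
Proof. by rewrite exprn_gt0 // exprn_ile1 // ltW. Qed.

(** In [quad_bound] and [step_bound], a, f, d, g and mu bound |A|, the sum of the
    |F_ij|, the off-star part W_k, the correction C_k and M_k respectively.
    As mu and one of the two factors d of the last term are at most e^3, the
    contraction factor e^2 can be taken out, and the remaining e is absorbed by
    f (a + 1) (f + 2). *)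
Lemma quad_bound (d : R) (g := d * f) (mu := e ^+ 3) : 0 <= d -> d <= e ^+ 3 ->
  g * mu + mu * g + g * (a + mu) * g <= d * e ^+ 2.
Proof.
move=> d0 de; rewrite /g /mu.
have a10 : 0 <= a + 1 by rewrite addr_ge0.
have fa : 0 <= f * (a + 1) by rewrite mulr_ge0.
have e30 : 0 <= e ^+ 3 by rewrite exprn_ge0 // ltW.
have e2 : 0 <= e ^+ 2 by rewrite exprn_ge0 // ltW.
have e31 : e ^+ 3 <= 1 by rewrite exprn_ile1 // ltW.
have -> : d * f * e ^+ 3 + e ^+ 3 * (d * f) + d * f * (a + e ^+ 3) * (d * f) =
   d * (2 * f * e ^+ 3 + f ^+ 2 * (a + e ^+ 3) * d) by ring.
apply: ler_wpM2l => //.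
have h1 : f ^+ 2 * (a + e ^+ 3) * d <= f ^+ 2 * (a + 1) * e ^+ 3.
  apply: ler_pM => //; rewrite ?mulr_ge0 ?exprn_ge0 ?addr_ge0 //.
  by apply: ler_wpM2l; rewrite ?exprn_ge0 // lerD2l.
have h2 : 2 * f * e ^+ 3 <= 2 * f * (a + 1) * e ^+ 3.
  apply: ler_wpM2r => //; rewrite ler_peMr ?mulr_ge0 //; move: a0; lra.
apply: le_trans (lerD h2 h1) _.
have -> : 2 * f * (a + 1) * e ^+ 3 + f ^+ 2 * (a + 1) * e ^+ 3 =
  e ^+ 2 * (e * (f * (a + 1) * (f + 2))) by ring.
by rewrite ler_piMr // ltW.
Qed.

(** The first two terms bound C^T A + A C.  They are only of order d, but the
    constant f (a + 1) (f + 2) costs no more than 1 / e. *)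
Lemma step_bound (d : R) (g := d * f) (mu := e ^+ 3) : 0 <= d -> d <= e ^+ 3 ->
  g * a + a * g + (g * mu + mu * g + g * (a + mu) * g) <= d / e.
Proof.
move=> d0 de; rewrite /g /mu.
have a10 : 0 <= a + 1 by rewrite addr_ge0.
have e30 : 0 <= e ^+ 3 by rewrite exprn_ge0 // ltW.
have e31 : e ^+ 3 <= 1 by rewrite exprn_ile1 // ltW.
have d1 : d <= 1 by apply: le_trans e31.
have -> : d * f * a + a * (d * f) +
   (d * f * e ^+ 3 + e ^+ 3 * (d * f) + d * f * (a + e ^+ 3) * (d * f)) =
   d * (f * (a + e ^+ 3) * (f * d + 2)) by ring.
apply: ler_wpM2l => //.
apply: (@le_trans _ _ (f * (a + 1) * (f + 2))).
  have fd0 : 0 <= f * d by rewrite mulr_ge0.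
  apply: ler_pM; rewrite ?mulr_ge0 ?addr_ge0 //.
    by apply: ler_wpM2l => //; rewrite lerD2l.
  by rewrite lerD2r ler_piMr.
by rewrite -[leRHS]mul1r ler_pdivlMr // mulrC ltW.
Qed.

Lemma ef_le1 : e * f <= 1.
Proof.
apply: le_trans (ltW ef); apply: ler_wpM2l; first exact: ltW.
apply: (@le_trans _ _ (f * (a + 1))).
  by rewrite ler_peMr //; move: a0; lra.
by rewrite ler_peMr ?mulr_ge0 ?addr_ge0 //; move: f0; lra.
Qed.

Definition off_rate k : R := e ^+ (2 * k + 5).
(** The increments of [size_rate] and [prod_rate] are about half of e^(2k+3) and
    of e^(2k+1); both exceed the corresponding increments of the iteration, which
    are at most e^(2k+4) times a factor close to 1. *)
Definition size_rate k : R := e ^+ 3 * (1 - e ^+ (2 * k) / 2).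
Definition prod_rate k : R := e / 2 * (1 - e ^+ (2 * k)).

Lemma off_rate_ge0 k : 0 <= off_rate k.
Proof. by rewrite exprn_ge0 // ltW. Qed.

Lemma off_rate_le k : off_rate k <= e ^+ 3.
Proof. by rewrite /off_rate ler_wiXn2l // ?ltW // addnC. Qed.

Lemma off_rateS k : off_rate k * e ^+ 2 = off_rate k.+1.
Proof. by rewrite /off_rate -exprD mulnS addnC addnA. Qed.

Lemma size_rate_le k : size_rate k <= e ^+ 3.
Proof.
have /andP[x0 _] := exp_even_bounds k.
rewrite /size_rate ler_piMr ?exprn_ge0 ?ltW //; move: x0; lra.
Qed.

Lemma size_rate0 : e ^+ 5 <= size_rate 0.
Proof.
rewrite /size_rate muln0 expr0 (_ : 5%N = (3 + 2)%N) // exprD ler_wpM2l //.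
  by rewrite exprn_ge0 // ltW.
by move: e0 e3; nra.
Qed.

Lemma size_rateS k : off_rate k / e <= size_rate k.+1 - size_rate k.
Proof.
have /andP[x0 x1] := exp_even_bounds k.
have -> : off_rate k / e = e ^+ 3 * (e ^+ (2 * k) * e).
  by rewrite /off_rate exprD (exprSr _ 4) mulrA mulfK ?gt_eqF //; ring.
rewrite /size_rate mulnS exprD -mulrBr ler_wpM2l //.
  by rewrite exprn_ge0 // ltW.
move: x0 e0 e3; set x := e ^+ (2 * k) => x0 ? ?.
rewrite (_ : _ - _ = x * ((1 - e ^+ 2) / 2)); last by field.
rewrite ler_pM2l //; nra.
Qed.

Lemma prod_rate_le k : 0 <= prod_rate k <= e / 2.
Proof.
have /andP[x0 x1] := exp_even_bounds k.
have e20 : 0 <= e / 2 by rewrite divr_ge0 ?ltW.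
rewrite /prod_rate mulr_ge0 ?subr_ge0 //= ler_piMr //; move: x0; lra.
Qed.

Lemma prod_rateS k :
  off_rate k * f + prod_rate k * (off_rate k * f) <= prod_rate k.+1 - prod_rate k.
Proof.
have /andP[x0 x1] := exp_even_bounds k.
have /andP[p0 pe] := prod_rate_le k.
have df : off_rate k * f <= e ^+ (2 * k) * e ^+ 4.
  rewrite (_ : _ * f = e ^+ (2 * k) * e ^+ 4 * (e * f)).
    by rewrite ler_piMr ?ef_le1 // mulr_ge0 // ?exprn_ge0 // ltW.
  by rewrite /off_rate exprD; ring.
rewrite -[X in X + _]mul1r -mulrDl.
apply: (@le_trans _ _ (2 * (e ^+ (2 * k) * e ^+ 4))).
  apply: ler_pM => //; rewrite ?mulr_ge0 ?off_rate_ge0 ?addr_ge0 //.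
  by move: pe e1; lra.
rewrite /prod_rate mulnS exprD; move: x0; set x := e ^+ (2 * k) => x0.
rewrite (_ : e / 2 * _ - _ = x * (e * ((1 - e ^+ 2) / 2))); last by field.
rewrite mulrCA ler_pM2l // (exprS e 3) mulrCA ler_pM2l //.
have e27 : e ^+ 3 <= e / 9.
  rewrite exprSr -ler_pdivlMr // -mulrA [_ * e^-1]mulrC mulrA mulfV ?gt_eqF //.
  by move: e0 e3; rewrite mul1r; nra.
by move: e27 e0 e3; nra.
Qed.

(** The first factor already gives 1 + e; the rest of the proof shows that the
    infinite product is finite. *)
Lemma limn_prod_ge : 1 + e <= limn (fun k => \prod_(i < k) (1 + e ^+ (2 * i + 1))).
Proof.
set Q := fun k => _.
have QS k : Q k.+1 = Q k * (1 + e ^+ (2 * k + 1)) by rewrite /Q big_ord_recr.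
have Q0 k : 0 <= Q k.
  by apply: prodr_ge0 => i _; rewrite addr_ge0 // exprn_ge0 // ltW.
have ndQ : nondecreasing_seq Q.
  apply/nondecreasing_seqP => k; rewrite QS ler_peMr //.
  by rewrite lerDl exprn_ge0 // ltW.
have Qle k : Q k <= 2 - e ^+ (2 * k).
  (* The bound 2 - e^(2k), unlike the constant 2, is preserved by a factor
     1 + e^(2k+1). *)
  elim: k => [|k IH]; first by rewrite /Q big_ord0 muln0 expr0; lra.
  rewrite QS; apply: le_trans (ler_wpM2r _ IH) _.
    by rewrite addr_ge0 // exprn_ge0 // ltW.
  have /andP[x0 x1] := exp_even_bounds k.
  rewrite mulnS (exprD e 2) (exprD e _ 1) expr1.
  move: x0 x1; set x := e ^+ (2 * k) => x0 x1.
  have : 0 <= x * (1 - e ^+ 2 - 2 * e + x * e).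
    rewrite mulr_ge0 ?(ltW x0) //.
    have : 0 <= x * e by rewrite mulr_ge0 ?ltW.
    by move: e0 e3; nra.
  by lra.
have cQ : cvgn Q.
  apply: nondecreasing_is_cvgn => //; exists 2 => _ [k _ <-].
  apply: le_trans (Qle k) _; have /andP[x0 _] := exp_even_bounds k.
  by move: x0; lra.
by have := nondecreasing_cvgn_le ndQ cQ 1%N; rewrite {1}/Q big_ord1 muln0 expr1.
Qed.

End Estimates.

(** * Convergence of the reduction *)

Section Convergence.
Context {R : realType} {n : nat}.
Local Notation M := 'M[R[i]]_n.
Local Notation N := (@Normc.normc R).
Variables (A : M) (D : 'M[bool]_n) (F : 'I_n -> 'I_n -> M) (e : R).
Hypotheses (hF : admissible A D F) (e0 : 0 < e) (e3 : e * 3 < 1)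
  (ef : e * (fsum F * (fnorm A + 1) * (fsum F + 2)) < 1).

Let a0 : 0 <= fnorm A := fnorm_ge0 A.
Let U := [set E : M | fnorm E < e ^+ 5].

Lemma fsum_ge0 : 0 <= fsum F.
Proof. by apply: sumr_ge0 => i _; apply: sumr_ge0 => j _; exact: fnorm_ge0. Qed.
Let f0 := fsum_ge0.

Lemma majorized_Cseq k :
  majorized U (fun E => offstar D (Mseq A F E k)) (off_rate e k) ->
  majorized U (fun E => Cseq A F E k) (off_rate e k * fsum F).
Proof.
move/(majorized_Ccorr F); under eq_fun do rewrite (Ccorr_offstar hF).
by [].
Qed.

Lemma majorized_Mseq k :
  majorized U (fun E => offstar D (Mseq A F E k)) (off_rate e k) /\
  majorized U (fun E => Mseq A F E k) (size_rate e k).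
Proof.
have idU : majorized U id (e ^+ 5) by apply: majorized_id => E /ltW.
elim: k => [|k [offk Mk]].
  split; first exact: majorized_mask.
  exact: majorized_le (size_rate0 e0 e3) idU.
have Ck := majorized_Cseq offk.
have Mk' : majorized U (fun E => Mseq A F E k) (e ^+ 3).
  exact: majorized_le (size_rate_le e0 e3 k) Mk.
have d0 := off_rate_ge0 e0 k; have d3 := off_rate_le e0 e3 k.
have CtM := majorizedM (majorized_tr Ck) Mk'.
have MC := majorizedM Mk' Ck.
have AM := majorizedD (majorized_cst U A) Mk'.
have CAC := majorizedM (majorizedM (majorized_tr Ck) AM) Ck.
have Q := majorizedD (majorizedD CtM MC) CAC.
split.
  (* Masking the expansion of the quadratic part, not that of M_(k+1), keeps the
     cancelled linear terms out of the majorant. *)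
  rewrite -off_rateS; under eq_fun do rewrite (offstar_MseqS hF).
  apply: majorized_mask.
  exact: majorized_le (quad_bound a0 f0 e0 e3 ef d0 d3) Q.
have CA := majorizedM (majorized_tr Ck) (majorized_cst U A).
have AC := majorizedM (majorized_cst U A) Ck.
have incr := majorizedD (majorizedD CA AC) Q.
have {}incr : majorized U (fun E => Mseq A F E k.+1 - Mseq A F E k)
    (size_rate e k.+1 - size_rate e k).
  apply: majorized_le (majorized_ext _ incr).
    apply: le_trans (size_rateS e0 e3 k).
    exact: (step_bound a0 f0 e0 e3 ef d0 d3).
  by move=> E; rewrite MseqS !(addrAC _ _ (- Mseq A F E k)) subrr add0r.
have := majorizedD Mk incr; rewrite addrC subrK.
by under eq_fun do rewrite addrC subrK.
Qed.

Lemma majorized_partial_prod k :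
  majorized U (fun E => partial_prod A F E k - 1%:M) (prod_rate e k) /\
  majorized U (fun E => partial_prod A F E k.+1 - partial_prod A F E k)
    (prod_rate e k.+1 - prod_rate e k).
Proof.
have step l : majorized U (fun E => partial_prod A F E l - 1%:M) (prod_rate e l) ->
  majorized U (fun E => partial_prod A F E l.+1 - partial_prod A F E l)
    (prod_rate e l.+1 - prod_rate e l).
  move=> Pl; have Cl := majorized_Cseq (majorized_Mseq l).1.
  have incr := majorizedD Cl (majorizedM Pl Cl).
  apply: majorized_le (majorized_ext _ incr).
    exact: prod_rateS a0 f0 e0 e3 ef l.
  move=> E; rewrite partial_prodS mulmxDr mulmx1 mulmxBl mul1mx.
  by rewrite addrC subrK [RHS]addrC addKr.
suff Pk : majorized U (fun E => partial_prod A F E k - 1%:M) (prod_rate e k).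
  by split => //; exact: step.
elim: k => [|k Pk].
  under eq_fun do rewrite partial_prod0 subrr.
  have := majorized_cst U 0; apply: majorized_le.
  by rewrite fnorm0 (andP (prod_rate_le e0 e3 0)).1.
have := majorizedD Pk (step k Pk); rewrite addrC subrK.
under eq_fun do rewrite addrC addrA subrK.
by [].
Qed.

(** A small constant matrix serves as the point of U without zero entries. *)
Lemma partial_prod_limit : exists S : M -> M,
  (forall E, U E -> mxcvgc (partial_prod A F E) (S E)) /\
  (forall i j, power_series_on U (fun E => S E i j)).
Proof.
have eta0 : 0 < e ^+ 5 / (n * n).+1%:R by rewrite divr_gt0 // exprn_gt0.
have etaN : N (e ^+ 5 / (n * n).+1%:R)%:C = e ^+ 5 / (n * n).+1%:R.
  by rewrite /= expr0n addr0 sqrtr_sqr ger0_norm // ltW.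
apply: (@majorized_series _ _ U (fun k E => partial_prod A F E k)
  (fun k => fnorm (1%:M : M) + prod_rate e k) (fnorm (1%:M : M) + e / 2)
  (const_mx (e ^+ 5 / (n * n).+1%:R)%:C)).
- apply: fnorm_lt => [|i j]; first by rewrite exprn_gt0.
  by rewrite mxE etaN.
- move=> i j; rewrite mxE; apply/eqP => /(congr1 N).
  by rewrite etaN Normc.normc0 => /eqP; rewrite gt_eqF.
- under eq_fun do rewrite partial_prod0.
  apply: majorized_le (majorized_cst U _).
  by rewrite lerDl (andP (prod_rate_le e0 e3 0)).1.
- move=> k; rewrite opprD addrACA subrr add0r.
  exact: (majorized_partial_prod k).2.
- by move=> k; rewrite lerD2l (andP (prod_rate_le e0 e3 k)).2.
Qed.

(** The partial products carry A + E to A + M_k, so both claims are limits of the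
    bounds on M_k and on its off-star part. *)
Lemma reduction_in_star_space E S : U E -> mxcvgc (partial_prod A F E) S ->
  S^T *m (A + E) *m S - A \in star_space D /\
  fnorm (S^T *m (A + E) *m S - A) <= e ^+ 3.
Proof.
move=> UE PS.
have Mlim : mxcvgc (Mseq A F E) (S^T *m (A + E) *m S - A).
  rewrite (_ : Mseq A F E = fun k =>
    (partial_prod A F E k)^T *m (A + E) *m partial_prod A F E k - A); last first.
    by apply/funext => k; exact: MseqE.
  apply: mxcvgcD; last exact: mxcvgc_cst.
  apply: mxcvgcM => //; apply: mxcvgcM; first exact: mxcvgc_tr.
  exact: mxcvgc_cst.
split; last first.
  apply: fnorm_lim_le Mlim _ => k.
  apply: le_trans (size_rate_le e0 e3 k).
  exact: majorized_fnorm (majorized_Mseq k).2 _ UE.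
apply/star_spaceP => i j Dij; apply: cvgc_unique (Mlim i j) _ => d d0.
have : e ^+ k @[k --> \oo] --> (0 : R).
  by apply: cvg_expr; rewrite ger0_norm ?ltW //; move: e0 e3; lra.
move/cvgrPdist_le => /(_ _ d0); apply: filterS => k.
rewrite !sub0r normrN normc_opp; apply: le_trans.
have := entry_le_fnorm (offstar D (Mseq A F E k)) i j; rewrite mxE Dij => Mij.
apply: le_trans Mij _.
apply: le_trans (majorized_fnorm (majorized_Mseq k).1 UE) _.
rewrite ger0_norm ?exprn_ge0 ?(ltW e0) // /off_rate ler_wiXn2l ?(ltW e0) //.
  by move: e0 e3; lra.
by rewrite mul2n -addnn -addnA leq_addr.
Qed.

Lemma limit_close_to_id E S : U E -> mxcvgc (partial_prod A F E) S ->
  fnorm (S - 1%:M) <= e / 2.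
Proof.
move=> UE PS; apply: (@fnorm_lim_le _ _ (fun k => partial_prod A F E k - 1%:M)).
  by apply: mxcvgcD => //; exact: mxcvgc_cst.
move=> k; apply: le_trans (andP (prod_rate_le e0 e3 k)).2.
exact: majorized_fnorm (majorized_partial_prod k).1 _ UE.
Qed.

End Convergence.

Theorem theorem8p1 (R : realType) (n : nat) (A : 'M[R[i]]_n)
    (D : 'M[bool]_n) (F : 'I_n -> 'I_n -> 'M[R[i]]_n) (eps : R)
    (hD : [set: 'M[R[i]]_n] =
          [set P + Q | P in tangent A & Q in [set` star_space D]])
    (hF : admissible A D F)
    (heps0 : 0 < eps)
    (heps : eps < 1 / Num.max (fsum F * (fnorm A + 1) * (fsum F + 2)) 3) :
  let U := [set E : 'M[R[i]]_n | fnorm E < eps ^+ 5] in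
  let S := Sprod A F in
  (forall E : 'M[R[i]]_n, U E ->
    [/\ cvg (partial_prod A F E @ \oo),
        (S E)^T *m (A + E) *m S E - A \in star_space D,
        fnorm (S E - 1%:M) <
          - 1 + limn (fun k : nat => \prod_(i < k) (1 + eps ^+ (2 * i + 1))) &
        fnorm ((S E)^T *m (A + E) *m S E - A) <= eps ^+ 3]) /\
  analytic_reduction A D S U.
Proof.
move=> U S.
have max_gt0 : 0 < Num.max (fsum F * (fnorm A + 1) * (fsum F + 2)) 3.
  by rewrite lt_max ltr0n orbT.
have eps_max : eps * Num.max (fsum F * (fnorm A + 1) * (fsum F + 2)) 3 < 1.
  by rewrite -ltr_pdivlMr.
have e3 : eps * 3 < 1.
  by apply: le_lt_trans eps_max; rewrite ler_pM2l // le_max lexx orbT.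
have ef : eps * (fsum F * (fnorm A + 1) * (fsum F + 2)) < 1.
  by apply: le_lt_trans eps_max; rewrite ler_pM2l // le_max lexx.
have [T [Tlim Tps]] := partial_prod_limit hF heps0 e3 ef.
have PS E : U E -> mxcvgc (partial_prod A F E) (S E).
  by move=> /Tlim TE; apply/mxcvgcP; apply: (cvgP (T E)); apply/mxcvgcP.
have ST E : U E -> S E = T E.
  move=> UE; apply/matrixP => i j.
  exact: cvgc_unique (PS E UE i j) (Tlim E UE i j).
have reduced E : U E -> _ := fun UE =>
  reduction_in_star_space hF heps0 e3 ef UE (PS E UE).
have U0 : U 0 by rewrite /U /= fnorm0 exprn_gt0.
split=> [E UE|].
  have [inD normD] := reduced E UE; split => //.
    by apply: (cvgP (T E)); apply/mxcvgcP; exact: Tlim.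
  apply: le_lt_trans (limit_close_to_id hF heps0 e3 ef UE (PS E UE)) _.
  by have := limn_prod_ge heps0 e3; move: heps0; lra.
split.
- by apply: nbhs_fnorm_ball; rewrite exprn_gt0.
- move=> i j; have [c cT] := Tps i j; exists c => E UE.
  by rewrite (ST E UE); exact: cT.
- apply/matrixP => i j; apply: cvgc_unique (PS 0 U0 i j) _.
  by under eq_fun do rewrite partial_prod_at0; exact: cvgc_cst.
- by move=> E /reduced[].
Qed.
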